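(* Let $(x_n)_{n\in\mathbb{N}}$ be a sequence, let $X=\{x_n : n\in\mathbb{N}\}$, and let $\varrho\colon X\times X\to[0,\infty)$ be a mapping such that $\varrho(x,y)=\varrho(y,x)$ for all $x,y\in X$, and such that for some real number $s\ge 1$ one has $\varrho(x,z)\le s[\varrho(x,y)+\varrho(y,z)]$ for all $x,y,z\in X$. Then $\lim_{m,n\to\infty}\varrho(x_n,x_m)=0$ if and only if both of the following conditions hold: (a) $\lim_{n\to\infty}\varrho(x_{n+1},x_n)=0$; (b) for each sufficiently small $\delta>0$ there exist $n_0,p\in\mathbb{N}$ and a real number $\lambda$ with $0<\lambda<1$ such that for all $m,n>n_0$, the inequalities $0<\varrho(x_n,x_m)<\delta$ imply $\varrho(x_{n+p},x_{m+p})<\delta\lambda/s$.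
   Context: Here $\mathbb{N}=\{1,2,3,\dots\}$ (so $p\ge 1$). The number $s\ge1$ in condition (b) is the same constant as in the relaxed triangle inequality for $\varrho$. ''For each sufficiently small $\delta>0$'' means: there is $\delta_0>0$ such that the stated property holds for every $\delta\in(0,\delta_0)$; the numbers $n_0,p,\lambda$ may depend on $\delta$. The statement $\lim_{m,n\to\infty}\varrho(x_n,x_m)=0$ means that for every $\varepsilon>0$ there is $N\in\mathbb{N}$ such that $\varrho(x_n,x_m)<\varepsilon$ for all $m,n>N$ (including $m=n$). No condition relating $\varrho(x,y)=0$ to $x=y$ is assumed; in particular $\varrho(x,x)$ need not be $0$, and $\varrho(x,y)=0$ need not imply $x=y$. *)

(* Defs.v *)
From mathcomp Require Import all_boot all_order all_algebra.
From mathcomp Require Import all_classical all_reals all_analysis.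
Set Implicit Arguments.
Unset Strict Implicit.
Unset Printing Implicit Defensive.

Local Open Scope classical_set_scope.

(* The set X = {x_n : n >= 1}: sequences are indexed by the positive integers,
   so the value [x 0] is unused and need not belong to X. *)
Definition terms (T : Type) (x : nat -> T) : set T :=
  [set x n | n in [set n | (0 < n)%N]].

(* Main.v *)
Require Import Defs.
From mathcomp Require Import all_boot all_order all_algebra.
From mathcomp Require Import all_classical all_reals all_analysis.
From mathcomp Require Import ring lra.
Import Order.TTheory GRing.Theory Num.Theory.
Import numFieldNormedType.Exports.
Local Open Scope classical_set_scope.
Local Open Scope ring_scope.

(** Write d m n for rho (x m) (x n), where m, n > 0.

    If the double limit is 0, then (a) is immediate, and (b) holds with p = 1
    and lambda = 1/2, because d (n + 1) (m + 1) is eventually below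
    delta / (2 s).

    Conversely, by (a) and the relaxed triangle inequality, d (n + r) n tends
    to 0 uniformly in r <= p, for every fixed p ([small_gaps]). Fix delta, take
    n0, p and lambda from (b), and choose an anchor k > n0 beyond which all
    gaps d (n + r) n with r <= p are tiny. Then d (k + j p) k < delta for
    every j ([anchored_progression]), by induction on j: if d (k + j p) k > 0,
    then (b) gives d (k + (j + 1) p) (k + p) < delta lambda / s, and
    returning from k + p to k costs one tiny gap; the triangle inequality turns
    this into a bound delta lambda + (tiny), below delta. If d (k + j p) k = 0,
    then (b) says nothing, but d (k + (j + 1) p) k is at most s times the gap
    from k + j p to k + (j + 1) p. Every index n >= k is within r < p of some
    k + j p, so d n k <= 2 s delta, and passing through k gives
    d n m <= 4 s^2 delta for all m, n >= k ([uniformly_small]). *)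

(** The relaxed metric axioms for a function of two positive indices; d is a
    metric up to the factor s, except that d i j = 0 and i = j are not
    related. *)
Definition relaxed_metric {R : realType} (s : R) (d : nat -> nat -> R) :=
  [/\ forall i j, (0 < i)%N -> (0 < j)%N -> 0 <= d i j,
      forall i j, (0 < i)%N -> (0 < j)%N -> d i j = d j i &
      forall i j k, (0 < i)%N -> (0 < j)%N -> (0 < k)%N ->
        d i k <= s * (d i j + d j k)].

Lemma relaxed_metric_terms {R : realType} {T : Type} {x : nat -> T}
    {rho : T -> T -> R} {s : R} :
  (forall y z, terms x y -> terms x z -> 0 <= rho y z) ->
  (forall y z, terms x y -> terms x z -> rho y z = rho z y) ->
  (forall y z w, terms x y -> terms x z -> terms x w ->
     rho y w <= s * (rho y z + rho z w)) ->
  relaxed_metric s (fun i j => rho (x i) (x j)).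
Proof.
move=> rho_ge0 rho_sym rho_tri.
have xP i : (0 < i)%N -> terms x (x i) by move=> i_gt0; exists i.
by split=> *; [apply: rho_ge0|apply: rho_sym|apply: rho_tri]; exact: xP.
Qed.

Lemma cvg0_natP {R : realType} (u : nat -> R) :
  u n @[n --> \oo] --> (0 : R) <->
  forall e : R, 0 < e -> exists N, forall n, (N <= n)%N -> `|u n| < e.
Proof.
split=> [/cvgr0Pnorm_lt u0 e /u0 [N _ uN]|u0].
  by exists N => n leNn; exact: uN.
by apply/cvgr0Pnorm_lt => e /u0 [N uN]; exists N => // n /= leNn; exact: uN.
Qed.

Lemma cvg0_nat2P {R : realType} (u : nat * nat -> R) :
  u mn @[mn --> (\oo, \oo)] --> (0 : R) <->
  forall e : R, 0 < e ->
    exists N, forall m n, (N <= m)%N -> (N <= n)%N -> `|u (m, n)| < e.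
Proof.
split=> [/cvgr0Pnorm_lt u0 e /u0 [[A B] /= [[M _ AM] [N _ BN]] ABu]|u0].
  exists (maxn M N) => m n; rewrite !geq_max => /andP[leMm _] /andP[_ leNn].
  by apply: (ABu (m, n)); split; [exact: AM|exact: BN].
apply/cvgr0Pnorm_lt => e /u0 [N uN].
exists ([set m | (N <= m)%N], [set n | (N <= n)%N]).
  by split; exists N.
by move=> [m n] /= [leNm leNn]; exact: uN.
Qed.

Lemma small_gaps {R : realType} {s : R} {d : nat -> nat -> R} :
  1 <= s -> relaxed_metric s d ->
  (forall e : R, 0 < e -> exists N, forall n, (N <= n)%N -> `|d n.+1 n| < e) ->
  forall (p : nat) (e : R), 0 < e ->
  exists N, forall n r, (N <= n)%N -> (0 < n)%N -> (r <= p)%N ->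
    d (n + r)%N n < e.
Proof.
move=> s_ge1 [d_ge0 d_sym d_tri] d0.
have s_gt0 : 0 < s by lra.
have s2E (e : R) : s * (e / (2 * s) + e / (2 * s)) = e by field; lra.
elim=> [|p IHp] e e_gt0; have e2_gt0 : 0 < e / (2 * s) by apply: divr_gt0; lra.
  (* d n n need not vanish: go from n to n.+1 and back *)
  have [N dN] := d0 _ e2_gt0.
  exists N => n r leNn n_gt0; rewrite leqn0 => /eqP ->; rewrite addn0.
  apply: le_lt_trans (d_tri _ n.+1 _ _ _ _) _ => //.
  rewrite (d_sym n) // -[ltRHS]s2E ltr_pM2l //.
  by have := ltr_normlW (dN n leNn); lra.
have [M dM] := d0 _ e2_gt0; have [N dN] := IHp _ e2_gt0.
have [L dL] := IHp _ e_gt0.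
exists (maxn M (maxn N L)) => n r.
rewrite !geq_max => /and3P[leMn leNn leLn] n_gt0.
rewrite leq_eqVlt => /orP[/eqP ->|lt_rp]; last exact: dL.
rewrite addnS; apply: le_lt_trans (d_tri _ (n + p)%N _ _ _ _) _ => //.
  by rewrite addn_gt0 n_gt0.
rewrite -[ltRHS]s2E ltr_pM2l //.
have := ltr_normlW (dM (n + p)%N (leq_trans leMn (leq_addr _ _))).
by have := dN n p leNn n_gt0 (leqnn _); lra.
Qed.

(** The contraction condition is only available at positive distances, so the
    induction treats d (k + j p) k = 0 separately. *)
Lemma anchored_progression {R : realType} {s : R} {d : nat -> nat -> R}
    {delta lambda : R} {n0 p k : nat} :
  1 <= s -> relaxed_metric s d -> 0 < delta -> 0 < lambda < 1 ->
  (forall m n, (n0 < m)%N -> (n0 < n)%N -> 0 < d n m < delta ->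
     d (n + p)%N (m + p)%N < delta * lambda / s) ->
  (n0 < k)%N ->
  (forall n r, (k <= n)%N -> (r <= p)%N ->
     d (n + r)%N n < delta * (1 - lambda) / s) ->
  forall j, d (k + j * p)%N k < delta.
Proof.
move=> s_ge1 [d_ge0 d_sym d_tri] delta_gt0 /andP[la_gt0 la_lt1] contr lt_n0k gap.
have s_gt0 : 0 < s by lra.
have sK (a : R) : s * (a / s) = a by field; lra.
have k_gt0 : (0 < k)%N by exact: leq_ltn_trans lt_n0k.
have pos n : (0 < k + n)%N by rewrite addn_gt0 k_gt0.
have gap_le : delta * (1 - lambda) / s <= delta.
  by rewrite ler_pdivrMr //; nra.
elim=> [|j IHj].
  by rewrite mul0n; exact: lt_le_trans (gap k 0%N _ _) gap_le.
rewrite mulSnr addnA.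
have [dj_gt0|dj_le0] := ltP 0 (d (k + j * p)%N k).
  apply: le_lt_trans (d_tri _ (k + p)%N _ _ _ _) _ => //.
    by rewrite -addnA.
  have ctr : d (k + j * p + p)%N (k + p)%N < delta * lambda / s.
    by apply: contr; rewrite ?dj_gt0 ?IHj // (leq_trans lt_n0k) ?leq_addr.
  have -> : delta = s * (delta * lambda / s + delta * (1 - lambda) / s).
    by field; lra.
  by rewrite ltr_pM2l // ltrD // gap.
apply: le_lt_trans (d_tri _ (k + j * p)%N _ _ _ _) _ => //.
  by rewrite -addnA.
apply: (@le_lt_trans _ _ (s * d (k + j * p + p)%N (k + j * p)%N)).
  by rewrite ler_pM2l //; lra.
apply: (@lt_le_trans _ _ (s * (delta * (1 - lambda) / s))).
  by rewrite ltr_pM2l // gap // leq_addr.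
by rewrite sK; nra.
Qed.

Lemma uniformly_small {R : realType} {s : R} {d : nat -> nat -> R}
    {delta lambda : R} {n0 p : nat} :
  1 <= s -> relaxed_metric s d -> 0 < delta -> (0 < p)%N -> 0 < lambda < 1 ->
  (forall e : R, 0 < e -> exists N, forall n, (N <= n)%N -> `|d n.+1 n| < e) ->
  (forall m n, (n0 < m)%N -> (n0 < n)%N -> 0 < d n m < delta ->
     d (n + p)%N (m + p)%N < delta * lambda / s) ->
  exists k, (0 < k)%N /\ forall m n, (k <= m)%N -> (k <= n)%N ->
    d n m <= 4 * s ^+ 2 * delta.
Proof.
move=> s_ge1 dP delta_gt0 p_gt0 la01 d0 contr.
have s_gt0 : 0 < s by lra.
have [/andP[la_gt0 la_lt1] [d_ge0 d_sym d_tri]] := (la01, dP).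
have e_gt0 : 0 < delta * (1 - lambda) / s by rewrite divr_gt0 //; nra.
have [N dN] := small_gaps s_ge1 dP d0 p _ e_gt0.
pose k := maxn N n0.+1.
have lt_n0k : (n0 < k)%N by rewrite leq_maxr.
have k_gt0 : (0 < k)%N by exact: leq_ltn_trans lt_n0k.
have gap n r : (k <= n)%N -> (r <= p)%N ->
    d (n + r)%N n < delta * (1 - lambda) / s.
  move=> le_kn; apply: dN; last exact: leq_trans le_kn.
  by rewrite (leq_trans _ le_kn) ?leq_maxl.
have anchored := anchored_progression s_ge1 dP delta_gt0 la01 contr lt_n0k gap.
have near_k n : (k <= n)%N -> d n k <= 2 * s * delta.
  move=> le_kn; pose a := (k + (n - k) %/ p * p)%N.
  have nE : n = (a + (n - k) %% p)%N by rewrite /a -addnA -divn_eq subnKC.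
  have le_ka : (k <= a)%N by rewrite leq_addr.
  have a_gt0 : (0 < a)%N by exact: leq_trans le_ka.
  have n_gt0 : (0 < n)%N by exact: leq_trans le_kn.
  apply: le_trans (d_tri n a k n_gt0 a_gt0 k_gt0) _.
  have -> : 2 * s * delta = s * (delta + delta) by ring.
  rewrite ler_pM2l // lerD //; last exact/ltW/anchored.
  rewrite {1}nE; apply/ltW.
  apply: lt_le_trans (gap _ _ le_ka (ltnW (ltn_pmod _ p_gt0))) _.
  by rewrite ler_pdivrMr //; nra.
exists k; split=> // m n le_km le_kn.
have [m_gt0 n_gt0] := (leq_trans k_gt0 le_km, leq_trans k_gt0 le_kn).
apply: le_trans (d_tri n k m n_gt0 k_gt0 m_gt0) _.
rewrite (d_sym k m) //.
have -> : 4 * s ^+ 2 * delta = s * (2 * s * delta + 2 * s * delta) by ring.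
by rewrite ler_pM2l // lerD // near_k.
Qed.

Theorem lemma2 (R : realType) (T : Type) (x : nat -> T) (rho : T -> T -> R)
    (s : R)
    (rho_ge0 : forall y z, terms x y -> terms x z -> 0 <= rho y z)
    (rho_sym : forall y z, terms x y -> terms x z -> rho y z = rho z y)
    (s_ge1 : 1 <= s)
    (rho_tri : forall y z w, terms x y -> terms x z -> terms x w ->
       rho y w <= s * (rho y z + rho z w)) :
  rho (x mn.2) (x mn.1) @[mn --> (\oo, \oo)] --> (0 : R)
  <->
  (rho (x n.+1) (x n) @[n --> \oo] --> (0 : R))
  /\
  (exists2 delta0 : R, 0 < delta0 &
     forall delta : R, 0 < delta < delta0 ->
     exists n0 p : nat, exists lambda : R,
       [/\ (0 < n0)%N, (0 < p)%N, 0 < lambda < 1 &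
         forall m n : nat, (n0 < m)%N -> (n0 < n)%N ->
           0 < rho (x n) (x m) < delta ->
           rho (x (n + p)%N) (x (m + p)%N) < delta * lambda / s]).
Proof.
have s_gt0 : 0 < s by lra.
have dP := relaxed_metric_terms rho_ge0 rho_sym rho_tri.
have [d_ge0 _ _] := dP.
split=> [/cvg0_nat2P lim2|[/cvg0_natP lim1 [delta0 delta0_gt0 contr]]].
  split.
    apply/cvg0_natP => e /lim2 [N limN]; exists N => n leNn.
    exact: (limN n n.+1 leNn (leqW leNn)).
  exists 1 => // delta /andP[delta_gt0 _].
  have e_gt0 : 0 < delta * 2^-1 / s by rewrite divr_gt0 //; lra.
  have [N limN] := lim2 _ e_gt0.
  exists N.+1, 1%N, 2^-1; split=> //; first by lra.
  move=> m n ltNm ltNn _; apply: ltr_normlW.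
  by apply: (limN (m + 1)%N (n + 1)%N); rewrite addn1; do 3!apply: ltnW.
apply/cvg0_nat2P => e e_gt0.
have c_gt0 : 0 < 4 * s ^+ 2 :> R by rewrite mulr_gt0 // exprn_gt0.
(* delta < delta0 with 4 s^2 delta < e *)
pose delta := Num.min delta0 (e / (4 * s ^+ 2)) / 2.
have min_gt0 : 0 < Num.min delta0 (e / (4 * s ^+ 2)).
  by rewrite lt_min delta0_gt0 divr_gt0.
have delta_gt0 : 0 < delta by rewrite /delta; lra.
have : delta < Num.min delta0 (e / (4 * s ^+ 2)) by rewrite /delta; lra.
rewrite lt_min => /andP[lt_delta0 lt_deltae].
have delta_in : 0 < delta < delta0 by rewrite delta_gt0.
have [n0 [p [la [_ p_gt0 la01 step]]]] := contr _ delta_in.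
have [k [k_gt0 dk]] :=
  uniformly_small s_ge1 dP delta_gt0 p_gt0 la01 lim1 step.
exists k => m n le_km le_kn /=.
rewrite ger0_norm; last by apply: d_ge0; exact: leq_trans k_gt0 _.
apply: le_lt_trans (dk m n le_km le_kn) _.
by rewrite mulrC -ltr_pdivlMr.
Qed.
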